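(* Let $0<q<1$, let $k\ge0$ and $n\ge1$ be integers, and let $y\in\mathbb{C}$. Then $$y^nq^{n(n+k-1)/2}S_k(yq^n;q)=u_n(q^{k/2},-yq^k;q)\,S_k(y;q)-q^{k/2}\,u_{n-1}(q^{k/2},-yq^{k+1};q)\,S_k(y/q;q).$$
   Context: Notation: $(c;q)_n=\prod_{j=0}^{n-1}(1-cq^j)$, $(c_1,c_2;q)_n=(c_1;q)_n(c_2;q)_n$, $\genfrac{[}{]}{0pt}{}{n}{k}_q=\frac{(q;q)_n}{(q;q)_k(q;q)_{n-k}}$. The Stieltjes–Wigert polynomials are $S_k(x;q)=\frac{1}{(q;q)_k}\sum_{j=0}^k\genfrac{[}{]}{0pt}{}{k}{j}_q q^{j^2}(-x)^j$. For integers $n\ge0$, $$u_n(x,y;q)=\sum_{j=0}^{\lfloor n/2\rfloor}\frac{(y,q;q)_{n-j}}{(q,y;q)_j\,(q;q)_{n-2j}}\,y^jq^{j(j-1)}\,x^{n-2j},$$ where $(y;q)_{n-j}/(y;q)_j$ is understood as the polynomial $(yq^j;q)_{n-2j}$. *)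

(* Defs.v *)
From mathcomp Require Import all_boot all_order all_algebra.
From mathcomp Require Import complex.
From mathcomp Require Import reals exp.

Set Implicit Arguments.
Unset Strict Implicit.
Unset Printing Implicit Defensive.

Import GRing.Theory.
Local Open Scope ring_scope.

Definition qpoch (F : fieldType) (c q : F) (n : nat) : F :=
  \prod_(j < n) (1 - c * q ^+ j).

Definition qbinom (F : fieldType) (q : F) (n k : nat) : F :=
  qpoch q q n / (qpoch q q k * qpoch q q (n - k)).

Definition stieltjes_wigert (F : fieldType) (k : nat) (x q : F) : F :=
  (qpoch q q k)^-1 *
  \sum_(j < k.+1) qbinom q k j * q ^+ (j ^ 2) * (- x) ^+ j.

(* u_n(x, y; q); the quotient (y; q)_(n-j) / (y; q)_j, which may be 0 / 0, is
   the polynomial (y q^j; q)_(n-2j).  In q ^+ (j * j.-1), the truncated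
   predecessor is harmless since it only matters for j = 0. *)
Definition upoly (F : fieldType) (n : nat) (x y q : F) : F :=
  \sum_(j < (n./2).+1)
    qpoch (y * q ^+ j) q (n - 2 * j) * qpoch q q (n - j)
      / (qpoch q q j * qpoch q q (n - 2 * j))
    * y ^+ j * q ^+ (j * j.-1) * x ^+ (n - 2 * j).

(* Main.v *)
Require Import Defs.
From mathcomp Require Import all_boot all_order all_algebra.
From mathcomp Require Import complex.
From mathcomp Require Import reals exp.
From mathcomp Require Import ring lra zify.

Import Order.TTheory GRing.Theory Num.Theory.

Local Open Scope ring_scope.
Local Open Scope complex_scope.

(** Both sides of the identity, as sequences in [n], solve one second order
    recurrence, so it suffices to compare initial values.

    On the left, the coefficients of the Stieltjes-Wigert polynomial [S_k] have
    a simple ratio, which gives the three-term q-difference equation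
      [x S_k(x q) = (1 + x q^k) S_k(x) - S_k(x / q)]
    ([sw_qdiff], with [x = z q]).  Put [a = q^(k/2)] and [b = - y q^k].  Taking
    [x = y q^(n+1)], the sequence
    [f_n = y^n q^(n (n + k - 1) / 2) S_k(y q^n)] satisfies
      [f_(n+2) = a (1 - b q^(n+1)) f_(n+1) + b q^n f_n],
    with no division by [y].

    On the right, [u_(n+2) = x (1 - y q^(n+1)) u_(n+1) + y q^n u_n] by
    [upoly_rec].  The factors in this recurrence are unchanged when [(n, y)] is
    replaced by [(n - 1, y q)].  Hence [u_n(a, b)] and [u_(n-1)(a, b q)], with
    [u_(-1) = 0], both solve the recurrence of [f_n], and the right hand side
    is the combination of them that matches [f_0 = S_k(y)] and
    [f_1 = a ((1 + y q^k) S_k(y) - S_k(y / q))]. *)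

(** * Shifted factorials *)

Lemma qpoch0 (F : fieldType) (c q : F) : qpoch c q 0 = 1.
Proof. by rewrite /qpoch big_ord0. Qed.

Lemma qpochS (F : fieldType) (c q : F) (n : nat) :
  qpoch c q n.+1 = qpoch c q n * (1 - c * q ^+ n).
Proof. by rewrite /qpoch big_ord_recr. Qed.

Lemma qpochSl (F : fieldType) (c q : F) (n : nat) :
  qpoch c q n.+1 = (1 - c) * qpoch (c * q) q n.
Proof.
rewrite /qpoch big_ord_recl expr0 mulr1; congr (_ * _).
by apply: eq_bigr => i _; rewrite /= /bump add1n exprS mulrA.
Qed.

Lemma qpoch_neq0 (F : fieldType) (q : F) (n : nat) :
  (forall j, q ^+ j.+1 != 1) -> qpoch q q n != 0.
Proof.
move=> hq; apply/prodf_neq0 => i _.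
by rewrite -exprS subr_eq0 eq_sym.
Qed.

(** * The q-difference equation of the Stieltjes-Wigert polynomials *)

Lemma qbinom_ratio (F : fieldType) (q : F) (k j : nat) :
  (forall i, q ^+ i.+1 != 1) -> (j < k)%N ->
  qbinom q k j.+1 * (1 - q ^+ j.+1) = qbinom q k j * (1 - q ^+ (k - j)).
Proof.
move=> hq hj; rewrite /qbinom.
have -> : (k - j)%N = (k - j.+1).+1 by lia.
set d := (k - j.+1)%N; rewrite !qpochS -!exprS.
have nz i : qpoch q q i != 0 by exact: qpoch_neq0.
have nf i : 1 - q ^+ i.+1 != 0 by rewrite subr_eq0 eq_sym.
have := nz d; have := nz j; have := nf d; have := nf j.
move: (q ^+ j.+1) (q ^+ d.+1) (qpoch q q d) (qpoch q q j) (qpoch q q k).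
by move=> s t u v w h1 h2 h3 h4; field; rewrite ?h1 ?h2 ?h3 ?h4.
Qed.

(** The equation is [S_k(z) - S_k(z q) = z q (q^k S_k(z q) - S_k(z q^2))].  The
    constant term on the left and the top term on the right vanish, and
    comparing the coefficients of [z^(j+1)] leaves exactly the ratio of the
    consecutive q-binomial coefficients [qbinom_ratio]. *)
Lemma sw_qdiff (F : fieldType) (q : F) (k : nat) (z : F) :
  (forall i, q ^+ i.+1 != 1) ->
  z * q * stieltjes_wigert k (z * q ^+ 2) q =
  (1 + z * q ^+ k.+1) * stieltjes_wigert k (z * q) q - stieltjes_wigert k z q.
Proof.
move=> hq.
suff main : \sum_(j < k.+1) (qbinom q k j * q ^+ (j ^ 2) * (- z) ^+ j
                          - qbinom q k j * q ^+ (j ^ 2) * (- (z * q)) ^+ j)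
  = \sum_(j < k.+1) (z * q) *
      (q ^+ k * (qbinom q k j * q ^+ (j ^ 2) * (- (z * q)) ^+ j)
       - qbinom q k j * q ^+ (j ^ 2) * (- (z * q ^+ 2)) ^+ j).
  move: main; rewrite /stieltjes_wigert.
  rewrite -mulr_sumr !sumrB -mulr_sumr (exprS q k).
  move: (bigop _ _ _) (bigop _ _ _) (bigop _ _ _) => C B A main.
  have -> : A = B + z * q * (q ^+ k * B - C) by rewrite -main; ring.
  ring.
rewrite [LHS]big_ord_recl [RHS]big_ord_recr /=.
rewrite !expr0 subrr add0r.
have -> : q ^+ k * (qbinom q k k * q ^+ (k ^ 2) * (- (z * q)) ^+ k)
     - qbinom q k k * q ^+ (k ^ 2) * (- (z * q ^+ 2)) ^+ k = 0.
  rewrite (_ : - (z * q ^+ 2) = q * - (z * q)); last by ring.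
  by rewrite (exprMn _ q); ring.
rewrite mulr0 addr0; apply: eq_bigr => j _ /=.
rewrite /bump add1n.
have -> : - (z * q ^+ 2) = - z * q ^+ 2 by ring.
have -> : - (z * q) = - z * q by ring.
rewrite !exprMn -mulrBr.
have ratio := qbinom_ratio F q k j hq (ltn_ord j).
have hk : q ^+ k = q ^+ (k - j) * q ^+ j.
  by rewrite -exprD subnK // ltnW.
have -> : q ^+ (j.+1 ^ 2) = q ^+ (j ^ 2) * q ^+ j * q ^+ j * q.
  by rewrite -!exprD -exprSr; congr (_ ^+ _); lia.
rewrite hk (exprS (- z)).
transitivity (qbinom q k j.+1 * (1 - q ^+ j.+1)
              * (q ^+ (j ^ 2) * q ^+ j * q ^+ j * q * (- z * (- z) ^+ j))).
  by ring.
by rewrite ratio; ring.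
Qed.

(** * The recurrence of the polynomials u *)

(** The summand of [u_(d + 2 j)] which contains [x^d].  Indexing by [d] in
    place of [n] turns all truncated subtractions into additions. *)
Definition uterm (F : fieldType) (x y q : F) (d j : nat) : F :=
  qpoch (y * q ^+ j) q d * qpoch q q (d + j) / (qpoch q q j * qpoch q q d)
  * y ^+ j * q ^+ (j * j.-1) * x ^+ d.

(** Extending the summands by zero makes the range of summation independent
    of [n], up to a bound. *)
Definition uterm0 (F : fieldType) (x y q : F) (n j : nat) : F :=
  if (j.*2 <= n)%N then uterm F x y q (n - j.*2) j else 0.

Lemma upoly_uterm0 (F : fieldType) (x y q : F) (n N : nat) :
  (n./2 < N)%N -> upoly n x y q = \sum_(j < N) uterm0 F x y q n j.
Proof.
move=> hN; rewrite /upoly.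
rewrite (big_ord_widen _ (fun j => qpoch (y * q ^+ j) q (n - 2 * j)
  * qpoch q q (n - j) / (qpoch q q j * qpoch q q (n - 2 * j))
    * y ^+ j * q ^+ (j * j.-1) * x ^+ (n - 2 * j)) hN).
rewrite big_mkcond; apply: eq_bigr => j _.
have -> : (j < (n./2).+1)%N = (j.*2 <= n)%N by lia.
rewrite /uterm0; case: ifP => // hj; rewrite /uterm mul2n.
by have -> : (n - j.*2 + j = n - j)%N by lia.
Qed.

Lemma uterm_d0 (F : fieldType) (x y q : F) (d : nat) :
  (forall i, q ^+ i.+1 != 1) ->
  uterm F x y q d 0 = qpoch y q d * x ^+ d.
Proof.
move=> hq; rewrite /uterm addn0 mul0n !expr0 !mulr1 qpoch0 mul1r.
by rewrite mulfK ?qpoch_neq0.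
Qed.

Lemma uterm_0S (F : fieldType) (x y q : F) (j : nat) :
  (forall i, q ^+ i.+1 != 1) ->
  uterm F x y q 0 j.+1 = y * q ^+ (j.*2) * uterm F x y q 0 j.
Proof.
move=> hq; rewrite /uterm !add0n !qpoch0 !mulr1 !mul1r !divff ?qpoch_neq0 //.
have -> : (j.+1 * j.+1.-1 = j.*2 + j * j.-1)%N by case: j => [|j] /=; nia.
by rewrite exprD exprS; ring.
Qed.

(** After division by the common factors this is the identity
    [(1 - y q^(n-j)) (1 - q^(n+1-j)) = (1 - y q^n) (1 - q^(n+1-2j))
      + q^(n+1-2j) (1 - y q^(j-1)) (1 - q^j)], with [j + 1] in place of [j] and
    [n = d + 2 (j + 1)]. *)
Lemma uterm_SS (F : fieldType) (x y q : F) (d j : nat) :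
  (forall i, q ^+ i.+1 != 1) ->
  uterm F x y q d.+1 j.+1 =
    x * (1 - y * q ^+ (d + j.*2).+2) * uterm F x y q d j.+1
    + y * q ^+ (d + j.*2).+1 * uterm F x y q d.+1 j.
Proof.
move=> hq; rewrite /uterm.
rewrite (qpochS _ (y * q ^+ j.+1)) (qpochSl _ (y * q ^+ j)).
rewrite -[y * _ * q]mulrA -exprSr !addSn !addnS.
rewrite (qpochS _ q q (d + j).+1) (qpochS _ q q j) (qpochS _ q q d).
have -> : (j.+1 * j.+1.-1 = j + j + j * j.-1)%N by case: j => [|j] /=; nia.
rewrite -!mulrA -addnn !exprS !exprD.
have nz i : qpoch q q i != 0 by exact: qpoch_neq0.
have nf i : 1 - q * q ^+ i != 0 by rewrite -exprS subr_eq0 eq_sym.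
have := nz d; have := nz j; have := nf d; have := nf j.
set p := qpoch (y * (q * q ^+ j)) q d; move: p => p.
move: (q ^+ (j * j.-1)) (q ^+ j) (q ^+ d) (x ^+ d) (y ^+ j).
move: (qpoch q q d) (qpoch q q j) (qpoch q q (d + j).+1).
move=> u v w e s t xd yj h1 h2 h3 h4.
by field; rewrite ?h1 ?h2 ?h3 ?h4.
Qed.

Lemma uterm0_rec0 (F : fieldType) (x y q : F) (n : nat) :
  (forall i, q ^+ i.+1 != 1) ->
  uterm0 F x y q n.+1 0 = x * (1 - y * q ^+ n) * uterm0 F x y q n 0.
Proof.
by move=> hq; rewrite /uterm0 !double0 !subn0 !uterm_d0 // qpochS (exprS x) /=; ring.
Qed.

Lemma uterm0_recS (F : fieldType) (x y q : F) (n j : nat) :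
  (forall i, q ^+ i.+1 != 1) ->
  uterm0 F x y q n.+2 j.+1 =
    x * (1 - y * q ^+ n.+1) * uterm0 F x y q n.+1 j.+1
    + y * q ^+ n * uterm0 F x y q n j.
Proof.
move=> hq; rewrite /uterm0 doubleS !ltnS.
have [lt_jn|lt_nj|eq_jn] := ltngtP j.*2 n.
- have [d ->] : exists d, n = (d + j.*2).+1.
    by exists (n - j.*2).-1; lia.
  rewrite !subSS addnK subSn ?leq_addl // addnK.
  exact: uterm_SS.
- by rewrite !mulr0 addr0.
- by rewrite -eq_jn !subSS subnn mulr0 add0r; exact: uterm_0S.
Qed.

Lemma upoly0 (F : fieldType) (x y q : F) : upoly 0 x y q = 1.
Proof.
rewrite /upoly big_ord_recl big_ord0 /= muln0 subn0 !qpoch0.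
by rewrite !expr0 !mulr1 divr1 addr0.
Qed.

Lemma upoly1 (F : fieldType) (x y q : F) :
  (forall i, q ^+ i.+1 != 1) -> upoly 1 x y q = x * (1 - y).
Proof.
move=> hq; rewrite (@upoly_uterm0 _ _ _ _ 1 1) // big_ord_recl big_ord0 /=.
rewrite uterm0_rec0 // /uterm0 /= uterm_d0 // qpoch0.
by rewrite !expr0 !mulr1 addr0.
Qed.

(** The recurrence holds summand by summand once the sum for [u_n] is shifted
    by one place, so that its term [j] meets the terms [j + 1] of the others. *)
Lemma upoly_rec (F : fieldType) (x y q : F) (n : nat) :
  (forall i, q ^+ i.+1 != 1) ->
  upoly n.+2 x y q =
    x * (1 - y * q ^+ n.+1) * upoly n.+1 x y q + y * q ^+ n * upoly n x y q.
Proof.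
move=> hq.
rewrite (@upoly_uterm0 _ _ _ _ n.+2 n.+2); last by lia.
rewrite (@upoly_uterm0 _ _ _ _ n.+1 n.+2); last by lia.
rewrite (@upoly_uterm0 _ _ _ _ n n.+1); last by lia.
rewrite ![\sum_(_ < n.+2) _]big_ord_recl /= uterm0_rec0 //.
rewrite [X in _ = X + _]mulrDr !mulr_sumr -addrA -big_split; congr (_ + _).
by apply: eq_bigr => j _; rewrite /= /bump add1n uterm0_recS.
Qed.

(** * Comparison of the two solutions *)

(** Here [a] plays the role of [q^(k/2)], and [a^n q^(n(n-1)/2)] that of
    [q^(n (n + k - 1) / 2)]. *)
Lemma sw_upoly (F : fieldType) (q a y : F) (k n : nat) :
  q != 0 -> (forall i, q ^+ i.+1 != 1) -> a ^+ 2 = q ^+ k ->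
  y ^+ n.+1 * (a ^+ n.+1 * q ^+ 'C(n.+1, 2))
    * stieltjes_wigert k (y * q ^+ n.+1) q
  = upoly n.+1 a (- (y * q ^+ k)) q * stieltjes_wigert k y q
    - a * upoly n a (- (y * q ^+ k.+1)) q * stieltjes_wigert k (y / q) q.
Proof.
move=> q0 hq ha; pose S z := stieltjes_wigert k z q.
have SE z : stieltjes_wigert k z q = S z by [].
(* The q-difference equation at y q^(m+1), and at y itself. *)
have step m : y * q ^+ m.+1 * S (y * q ^+ m.+2) =
    (1 + y * q ^+ m.+1 * q ^+ k) * S (y * q ^+ m.+1) - S (y * q ^+ m).
  have := sw_qdiff _ _ k (y * q ^+ m) hq.
  rewrite !SE !exprS.
  have -> : y * q ^+ m * (q * (q * q ^+ 0)) = y * (q * (q * q ^+ m)) by ring.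
  have -> : y * q ^+ m * q = y * (q * q ^+ m) by ring.
  by move=> ->; ring.
have step0 : y * S (y * q) = (1 + y * q ^+ k) * S y - S (y / q).
  have := sw_qdiff _ _ k (y / q) hq.
  by rewrite !SE expr2 exprS !mulrA divfK.
have rec m : y ^+ m.+2 * (a ^+ m.+2 * q ^+ 'C(m.+2, 2)) * S (y * q ^+ m.+2) =
    a * (1 + y * q ^+ k * q ^+ m.+1)
      * (y ^+ m.+1 * (a ^+ m.+1 * q ^+ 'C(m.+1, 2)) * S (y * q ^+ m.+1))
    - y * q ^+ k * q ^+ m
      * (y ^+ m * (a ^+ m * q ^+ 'C(m, 2)) * S (y * q ^+ m)).
  have E i : q ^+ 'C(i.+1, 2) = q ^+ 'C(i, 2) * q ^+ i.
    by rewrite binS bin1 exprD.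
  transitivity (a * (y ^+ m.+1 * (a ^+ m.+1 * q ^+ 'C(m.+1, 2)))
                * (y * q ^+ m.+1 * S (y * q ^+ m.+2))).
    by rewrite (E m.+1) (exprS y m.+1) (exprS a m.+1); ring.
  rewrite step E (exprS a m) (exprS y m) -ha.
  ring.
rewrite !SE.
have base : y ^+ 1 * (a ^+ 1 * q ^+ 'C(1, 2)) * S (y * q ^+ 1) =
    upoly 1 a (- (y * q ^+ k)) q * S y
    - a * upoly 0 a (- (y * q ^+ k.+1)) q * S (y / q).
  rewrite upoly1 // upoly0 bin_small // expr0 !expr1.
  transitivity (a * (y * S (y * q))); first by ring.
  by rewrite step0; ring.
have [] : y ^+ n.+1 * (a ^+ n.+1 * q ^+ 'C(n.+1, 2)) * S (y * q ^+ n.+1) =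
    upoly n.+1 a (- (y * q ^+ k)) q * S y
    - a * upoly n a (- (y * q ^+ k.+1)) q * S (y / q) /\
  y ^+ n.+2 * (a ^+ n.+2 * q ^+ 'C(n.+2, 2)) * S (y * q ^+ n.+2) =
    upoly n.+2 a (- (y * q ^+ k)) q * S y
    - a * upoly n.+1 a (- (y * q ^+ k.+1)) q * S (y / q); last by [].
(* At n = 2 the recurrence would express u_(n-1) = u_1 through u_(-1); this case
   uses the explicit values of u_0 and u_1 instead. *)
elim: n => [|n [IH1 IH2]]; split => //.
- rewrite rec base upoly_rec // !upoly1 // !upoly0 bin_small // !expr0 !mulr1.
  by rewrite (exprS q k); ring.
- rewrite rec IH1 IH2 (upoly_rec _ _ _ _ n.+1) //.
  rewrite (upoly_rec _ _ (- (y * q ^+ k.+1)) _ n) //.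
  by rewrite (exprS q k) (exprS q n.+1) (exprS q n); ring.
Qed.

Theorem mainTheorem6 (R : realType) (q : R) (hq0 : 0 < q) (hq1 : q < 1)
    (k n : nat) (hn : (1 <= n)%N) (y : R[i]) :
  y ^+ n * (powR q (n%:R * (n%:R + k%:R - 1) / 2))%:C
    * stieltjes_wigert k (y * q%:C ^+ n) q%:C
  = upoly n (powR q (k%:R / 2))%:C (- (y * q%:C ^+ k)) q%:C
      * stieltjes_wigert k y q%:C
    - (powR q (k%:R / 2))%:C
      * upoly n.-1 (powR q (k%:R / 2))%:C (- (y * q%:C ^+ k.+1)) q%:C
      * stieltjes_wigert k (y / q%:C) q%:C.
Proof.
case: n hn => // n _.
have qge0 := ltW hq0.
have hE : powR q (n.+1%:R * (n.+1%:R + k%:R - 1) / 2)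
    = powR q (k%:R / 2) ^+ n.+1 * q ^+ 'C(n.+1, 2).
  rewrite -(powR_mulrn _ (powR_ge0 _ _)) -powRrM -(powR_mulrn _ qge0).
  rewrite -powRD; last by rewrite (gt_eqF hq0) implybT.
  congr (powR q _).
  have hb : ('C(n.+1, 2).*2 = n.+1 * n)%N.
    by rewrite bin2 even_halfK // oddM /= andNb.
  have : (2 * 'C(n.+1, 2)%:R = n.+1%:R * n%:R :> R).
    by rewrite -!natrM -hb mul2n.
  by rewrite -[n.+1]addn1 natrD; lra.
rewrite hE rmorphM !rmorphXn; apply: sw_upoly.
- by rewrite fmorph_eq0 gt_eqF.
- by move=> i; rewrite -rmorphXn fmorph_eq1 lt_eqF // exprn_ilt1.
- rewrite -!rmorphXn -(powR_mulrn _ (powR_ge0 _ _)) -powRrM.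
  by rewrite divfK ?pnatr_eq0 // powR_mulrn.
Qed.
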